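(* Let $\alpha\in[0,1)$ and let $G$ be a unicyclic odd-cycle graph of order $n\ge 3$. Then $\mu_{\alpha}(G)\le\mu_{\alpha}(Ki_{n,3})$, with equality if and only if $G\cong Ki_{n,3}$.
   Context: All graphs are finite, simple and undirected. A unicyclic odd-cycle graph is a connected graph with exactly one cycle, whose cycle has odd length. $Ki_{n,3}$ is the graph obtained from a triangle $K_3$ and a (disjoint) path $P_{n-3}$ on $n-3$ vertices by adding an edge between a vertex of $K_3$ and a terminal vertex of $P_{n-3}$ if $n>3$, and $Ki_{3,3}=K_3$. For a connected graph $G$ with distance function $d_G$, the transmission of a vertex $u$ is $T_G(u)=\sum_{v\in V(G)}d_G(u,v)$, $T(G)$ is the diagonal matrix of transmissions and $D(G)=(d_G(u,v))_{u,v\in V(G)}$ the distance matrix. For $\alpha\in[0,1)$, $D_{\alpha}(G)=\alpha T(G)+(1-\alpha)D(G)$, and $\mu_{\alpha}(G)$ (the distance $\alpha$-spectral radius) is the largest eigenvalue of the symmetric matrix $D_{\alpha}(G)$. *)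

(* Defs.v *)
From mathcomp Require Import all_boot all_order all_algebra.
From mathcomp Require Import classical_sets reals.

Set Implicit Arguments.
Unset Strict Implicit.
Unset Printing Implicit Defensive.

Import Order.TTheory GRing.Theory Num.Theory.

Record sgraph := SGraph {
  vertex :> finType;
  adj : rel vertex;
  adj_sym : symmetric adj;
  adj_irr : irreflexive adj }.

Definition isomorphic (G H : sgraph) : Prop :=
  exists2 f : G -> H, bijective f & forall x y : G, adj (f x) (f y) = adj x y.

Definition connected_graph (G : sgraph) : Prop :=
  forall u v : G, connect (@adj G) u v.

Definition is_cycle (G : sgraph) (c : seq G) : bool :=
  [&& 2 < size c, uniq c & cycle (@adj G) c].

(* A cycle is a subgraph, whereas the sequence listing its vertices depends on
   a starting point and a direction; its edge set does not. *)
Definition cycle_edges (G : sgraph) (c : seq G) : {set {set G}} :=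
  [set [set x; next c x] | x in c].

Definition unicyclic_odd (G : sgraph) : Prop :=
  connected_graph G /\
  exists c : seq G,
    [/\ is_cycle c, odd (size c) &
        forall c' : seq G, is_cycle c' -> cycle_edges c' = cycle_edges c].

Definition has_path (G : sgraph) (u v : G) (k : nat) : bool :=
  [exists p : k.-tuple G,
    [&& path (@adj G) u p, uniq (u :: p) & last u p == v]].

(* Paths have fewer than #|G| edges; the default value #|G| is taken only when
   u and v lie in different components. *)
Definition gdist (G : sgraph) (u v : G) : nat :=
  \big[minn/#|G|]_(k < #|G| | has_path u v k) k.

Definition transmission (G : sgraph) (u : G) : nat := \sum_(v : G) gdist u v.

(* The triangle is {0, 1, 2} and the path is 3 - 4 - ... - (n-1); it is attached
   by the edge 2 - 3. All edges other than 0 - 2 join consecutive numbers. *)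
Definition kite_adj (n : nat) : rel 'I_n := fun i j =>
  [|| [&& i != j, i < 3 & j < 3], i.+1 == j | j.+1 == i].

Lemma kite_adj_sym n : symmetric (@kite_adj n).
Proof.
by move=> i j; rewrite /kite_adj eq_sym [(i < 3) && _]andbC [(i.+1 == j) || _]orbC.
Qed.

Lemma kite_adj_irr n : irreflexive (@kite_adj n).
Proof. by move=> i; rewrite /kite_adj eqxx /= orbb gtn_eqF. Qed.

Definition kite (n : nat) : sgraph :=
  SGraph (@kite_adj_sym n) (@kite_adj_irr n).

Local Open Scope ring_scope.

Section DistanceAlphaMatrix.
Variables (R : realType) (alpha : R) (G : sgraph).

Definition transmission_mx : 'M[R]_#|G| :=
  diag_mx (\row_i (transmission (enum_val i))%:R).

Definition distance_mx : 'M[R]_#|G| :=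
  \matrix_(i, j) (gdist (enum_val i) (enum_val j))%:R.

Definition distance_alpha_mx : 'M[R]_#|G| :=
  alpha *: transmission_mx + (1 - alpha) *: distance_mx.

(* For nonempty G, the eigenvalues of this real symmetric matrix form a
   nonempty finite set, so the supremum is the largest eigenvalue. *)
Definition mu : R := sup [set a | eigenvalue distance_alpha_mx a]%classic.

End DistanceAlphaMatrix.

(* Main.v *)
Require Import Defs.
From mathcomp Require Import all_boot all_order all_algebra.
From mathcomp Require Import classical_sets reals.
From mathcomp Require Import zify ring lra.

Set Implicit Arguments.
Unset Strict Implicit.
Unset Printing Implicit Defensive.

Import Order.TTheory GRing.Theory Num.Theory.
Local Open Scope ring_scope.

(** For a positive vector [x], the form [x D_alpha x^T] is a sum of distances with positive weights,
    and by Perron-Frobenius it equals the spectral radius of [G] times [|x|^2] at a suitable such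
    [x]. So it is enough that for all positive weights some kite on the vertices of [G] has a
    larger weighted sum of distances, unless the distances of [G] are already those of a kite.
    For an odd cycle, average over the kites obtained by rotation. The other vertices are added one
    at a time: moving the weights of a new vertex to its neighbour reduces to the graph before,
    and a kite with a pendant vertex is treated by moving the pendant vertex, then the
    triangle, along the path: the weighted sum is a strictly convex function of the position. *)

(** * Distances in kites *)

Definition path_dist (i j : nat) : nat := (i - j) + (j - i).

(* Distance in [kite n]: the edge 0 - 2 is a shortcut from 0 to all later vertices but 1. *)
Definition kite_dist (i j : nat) : nat :=
  path_dist i j - ((i == 0) && (1 < j) || (j == 0) && (1 < i))%N.

Lemma kite_distC i j : kite_dist i j = kite_dist j i.
Proof. rewrite /kite_dist /path_dist; lia. Qed.

Lemma kite_distxx i : kite_dist i i = 0%N.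
Proof. rewrite /kite_dist /path_dist; lia. Qed.

(* The index in [rot r c] of the element of index [i] in [c], when [c] has size [n]. *)
Definition rot_pos (n r i : nat) : nat := if (r <= i)%N then (i - r)%N else (i + n - r)%N.

(* Rotating by [r] puts the two vertices at distance [j - i] or [n - (j - i)] along the path; the
   shortcut costs at most 1, and only when one of them comes first. *)
Lemma sum_rot_kite_dist n i j : (i < j < n)%N ->
  (2 * ((j - i) * (n - (j - i))) <=
   (\sum_(0 <= r < n) kite_dist (rot_pos n r i) (rot_pos n r j)) + 2)%N.
Proof.
move=> /andP[ij jn]; set F := BIG_F.
have sum_ge (c l m : nat) : (forall r, l <= r < m -> c <= F r)%N ->
    ((m - l) * c <= \sum_(l <= r < m) F r)%N.
  move=> cF; rewrite -sum_nat_const_nat big_nat [leqRHS]big_nat.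
  by apply: leq_sum => r /cF.
have split_last l m : (l <= m)%N -> (\sum_(l <= r < m.+1) F r = \sum_(l <= r < m) F r + F m)%N.
  by move=> lm; rewrite big_nat_recr.
rewrite (@big_cat_nat _ _ _ i.+1) //=; last by lia.
rewrite (@big_cat_nat _ _ _ j.+1 i.+1 n) //=; last by lia.
rewrite !split_last; [|lia..].
have s1 := sum_ge (j - i)%N 0%N i.
have s2 := sum_ge (n - (j - i))%N i.+1 j.
have s3 := sum_ge (j - i)%N j.+1 n.
have Fi : (j - i <= F i + 1)%N.
  by rewrite /F /rot_pos /= /kite_dist /path_dist; do ?[case: ifP => ?]; lia.
have Fj : (n - (j - i) <= F j + 1)%N.
  by rewrite /F /rot_pos /= /kite_dist /path_dist; do ?[case: ifP => ?]; lia.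
have {}s1 : (i * (j - i) <= \sum_(0 <= r < i) F r)%N.
  rewrite -[X in (X * _)%N]subn0; apply: s1 => r hr.
  by rewrite /F /rot_pos /= /kite_dist /path_dist; do ?[case: ifP => ?]; lia.
have {}s2 : ((j - i.+1) * (n - (j - i)) <= \sum_(i.+1 <= r < j) F r)%N.
  by apply: s2 => r hr; rewrite /F /rot_pos /= /kite_dist /path_dist; do ?[case: ifP => ?]; lia.
have {}s3 : ((n - j.+1) * (j - i) <= \sum_(j.+1 <= r < n) F r)%N.
  by apply: s3 => r hr; rewrite /F /rot_pos /= /kite_dist /path_dist; do ?[case: ifP => ?]; lia.
move: s1 s2 s3 Fi Fj; move: (\sum_(0 <= r < i) F r)%N (\sum_(i.+1 <= r < j) F r)%N => A B.
move: (\sum_(j.+1 <= r < n) F r)%N (F i) (F j) => C x y.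
have [t jE] : exists t, j = (i + t.+1)%N by exists (j - i.+1)%N; lia.
have [k nE] : exists k, n = (j + k.+1)%N by exists (n - j.+1)%N; lia.
rewrite {}nE {}jE (_ : i + t.+1 - i = t.+1)%N; last by lia.
rewrite (_ : i + t.+1 + k.+1 - t.+1 = i + k.+1)%N; last by lia.
rewrite (_ : i + t.+1 - i.+1 = t)%N; last by lia.
rewrite (_ : i + t.+1 + k.+1 - (i + t.+1).+1 = k)%N; last by lia.
nia.
Qed.

(** Here [m] and [l] are the two arcs of an odd cycle between a pair of vertices, [x] is their
    distance and [y] its sum over the rotated kites. The arcs differ by parity; if [m < l], then
    [2 m l - (m + l) m = m (l - m)], which is at least 2 unless the cycle is a triangle. *)
Lemma odd_split_le l m x y : odd (m + l)%N -> (3 < m + l)%N -> (0 < m)%N -> (0 < l)%N ->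
  (x <= minn m l)%N -> (2 * (m * l) <= y + 2)%N -> ((m + l) * x <= y)%N.
Proof.
move=> odd_ml ml m0 l0; wlog lt_ml : l m odd_ml ml m0 l0 / (m < l)%N => [IH|] x_le y_ge.
  have [/IH->//|l_le] := ltnP m l.
  have lt_lm : (l < m)%N.
    by rewrite ltn_neqAle l_le andbT; apply: contraTneq odd_ml => ->; rewrite addnn odd_double.
  rewrite addnC in odd_ml ml; rewrite minnC in x_le; rewrite (mulnC m) in y_ge.
  by rewrite addnC; apply: (IH m l).
have [q lE] : exists q, l = (m + q.+1)%N by exists (l - m.+1)%N; lia.
have xm : (x <= m)%N by move: x_le; lia.
have : ((m + l) * x <= (m + l) * m)%N by rewrite leq_mul2l xm orbT.
have : (2 <= m * q.+1)%N.
  case: m q m0 ml lE {x_le y_ge odd_ml lt_ml xm} => [|[|m]] [|q] //; lia.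
rewrite lE in y_ge *; nia.
Qed.

(** The increments grow with the index: if [f] rises just after [i], it keeps rising up to [m];
    otherwise it rises strictly on the way back from [i] to [l]. *)
Lemma strict_convex_lt_ends (R : realDomainType) (f : nat -> R) (l m : nat) :
    (forall i, (l < i < m)%N -> f i *+ 2 < f i.-1 + f i.+1) ->
  forall i, (l < i < m)%N -> f i < f l \/ f i < f m.
Proof.
move=> cvx i /andP[li im].
have [lt_i|ge_i] := ltP (f i) (f i.+1).
  right.
  have incr k : (i <= k < m)%N -> f k < f k.+1.
    elim: k => [|k IH] hk; first by have := hk; rewrite leqn0 => /andP[/eqP i0 _]; lia.
    have [->//|nik] := eqVneq k.+1 i.
    have := cvx k.+1 ltac:(lia); have := IH ltac:(lia); rewrite /=; lra.
  have {}incr k : (i < k <= m)%N -> f i < f k.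
    elim: k => [|k IH] hk; first by lia.
    have [<-|nik] := eqVneq i k; first by apply: incr; lia.
    by apply: lt_trans (IH _) (incr _ _); lia.
  by apply: incr; lia.
left.
have incr k : (l < i - k)%N -> f (i - k)%N < f (i - k).-1.
  elim: k => [|k IH] hk.
    by have := cvx i ltac:(lia); rewrite subn0; lra.
  have := cvx (i - k.+1)%N ltac:(lia); have := IH ltac:(lia).
  rewrite subnS prednK; last by lia.
  lra.
have {}incr k : (k <= i - l)%N -> (0 < k)%N -> f i < f (i - k)%N.
  elim: k => [|k IH] // hk _.
  case: k IH hk => [|k] IH hk; first by have := incr 0%N; rewrite subn0 subn1; apply; lia.
  by apply: lt_trans (IH _ _) _; rewrite ?[(i - k.+2)%N]subnS //; [lia|apply: incr; lia].
by have := incr (i - l)%N; rewrite subKn; [apply; lia|lia].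
Qed.

Section SequenceDistances.
Variables (T : eqType).
Implicit Types (s p : seq T).

Definition seq_kite_dist (s : seq T) (a b : T) : nat := kite_dist (index a s) (index b s).

(** Indices 0 and 1 are the triangle vertices off the path, and exchanging them is an automorphism
    of the kite. *)
Lemma seq_kite_dist_swap (x y : T) s : x != y ->
  seq_kite_dist (x :: y :: s) =2 seq_kite_dist (y :: x :: s).
Proof.
have [//|xy _] := eqVneq x y; move=> a b; rewrite /seq_kite_dist /=.
case: (eqVneq x a) => [<-|_]; case: (eqVneq x b) => [<-|_];
  rewrite ?(eq_sym y x) ?(negbTE xy) ?eqxx /kite_dist /path_dist; do ?case: ifP => _; lia.
Qed.

(** The distances once [v] is hung as a pendant vertex on [u], where [d] gives the distances between
    the other vertices. *)
Definition attach (v u : T) (d : T -> T -> nat) a b : nat :=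
  if a == v then (if b == v then 0 else (d u b).+1)
  else if b == v then (d a u).+1 else d a b.

Lemma index_rot (a : T) (c : seq T) r : uniq c -> a \in c -> (r < size c)%N ->
  index a (rot r c) = rot_pos (size c) r (index a c).
Proof.
move=> uc ac lt_r; have := ac; rewrite -index_mem => lt_a.
set pos := (X in _ = X).
have lt_pos : (pos < size c)%N by rewrite /pos /rot_pos; case: ifP; lia.
have {1}-> : a = nth a (rot r c) pos; last by rewrite index_uniq ?rot_uniq ?size_rot.
rewrite /rot nth_cat size_drop /pos /rot_pos; case: (leqP r (index a c)) => r_a.
  by rewrite ifT; [rewrite nth_drop subnKC ?nth_index | lia].
rewrite ifF; last by lia.
rewrite nth_take; last by lia.
by rewrite (_ : (_ - _ = index a c)%N) ?nth_index //; lia.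
Qed.

(* The path [p] with the extra vertex [x] joined to its vertices number [i] and [i + 1]. *)
Definition join_dist (i : nat) (x : T) p (a b : T) : nat :=
  let tri j := ((i - j) + (j - i.+1)).+1 in
  if a == x then (if b == x then 0 else tri (index b p))
  else if b == x then tri (index a p) else path_dist (index a p) (index b p).

Lemma index_rev (a : T) p : uniq p -> a \in p -> index a (rev p) = (size p - (index a p).+1)%N.
Proof.
move=> up ap; have lt_a : (index a p < size p)%N by rewrite index_mem.
have {1}-> : a = nth a (rev p) (size p - (index a p).+1)%N.
  by rewrite nth_rev; [rewrite subnSK // subKn ?nth_index // ltnW | lia].
by rewrite index_uniq ?rev_uniq // size_rev; lia.
Qed.

Lemma join_dist_first (x : T) p : x \notin p ->
  {in x :: p &, join_dist 0 x p =2 seq_kite_dist (x :: p)}.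
Proof.
move=> xp a b ap bp; rewrite /join_dist /seq_kite_dist /= ![x == _]eq_sym.
by case: eqP => _; case: eqP => _; rewrite /kite_dist /path_dist; lia.
Qed.

(** The triangle sits on the last two vertices of [p], and a kite is listed from its triangle on,
    hence the reversal. *)
Lemma join_dist_last (x : T) p : x \notin p -> uniq p -> (1 < size p)%N ->
  {in x :: p &, join_dist (size p - 2) x p =2 seq_kite_dist (x :: rev p)}.
Proof.
move=> xp up size_p a b; rewrite !inE /join_dist /seq_kite_dist /= ![x == _]eq_sym.
case: eqP => [_|_] /= ap; case: eqP => [_|_] /= bp; rewrite ?index_rev // /kite_dist /path_dist.
- by move: bp; rewrite -index_mem; move: (index b p) (size p) size_p => i n; lia.
- by move: ap; rewrite -index_mem; move: (index a p) (size p) size_p => i n; lia.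
- by move: ap bp; rewrite -!index_mem; move: (index a p) (index b p) (size p) => i j n; lia.
Qed.

(** A pendant vertex at the end lengthens the path. The size matters: appended to two vertices, [v]
    would close the triangle. *)
Lemma attach_last s (v : T) : uniq (v :: s) -> (2 < size s)%N ->
  {in v :: s &, attach v (last v s) (seq_kite_dist s) =2 seq_kite_dist (rcons s v)}.
Proof.
move=> /[dup] /index_last + /andP[vs us] size_s.
have last_s : last v s \in s by case: s size_s {vs us} => //= y s _; apply: mem_last.
rewrite /=; case: eqP last_s => [<-|_ _ [index_l]]; first by rewrite (negbTE vs).
have index_v : index v (rcons s v) = size s.
  by rewrite -cats1 index_cat (negbTE vs) /= eqxx addn0.
have index_s a : a \in s -> index a (rcons s v) = index a s.
  by move=> sa; rewrite -cats1 index_cat sa.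
move=> a b; rewrite !inE /attach /seq_kite_dist.
case: eqP => [->|_] /= sa; case: eqP => [->|_] /= sb; rewrite ?index_v ?index_s ?kite_distxx //.
- by move: sb; rewrite -index_mem /kite_dist /path_dist; lia.
- by move: sa; rewrite -index_mem /kite_dist /path_dist; lia.
Qed.

End SequenceDistances.

(** * Weighted sums of distances *)

Section WeightedSums.
Variables (R : realDomainType) (V : finType).
Implicit Types (w : V -> V -> R) (S : {set V}) (d : V -> V -> nat).

Definition wsum w S d : R := \sum_(a in S) \sum_(b in S) w a b * (d a b)%:R.

Definition positive w := forall a b, 0 < w a b.

Lemma eq_wsum w S d d' : {in S &, d =2 d'} -> wsum w S d = wsum w S d'.
Proof.
by move=> dd'; apply: eq_bigr => a aS; apply: eq_bigr => b bS; rewrite dd'.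
Qed.

Lemma wsumD w S d d' : wsum w S (fun a b => d a b + d' a b)%N = wsum w S d + wsum w S d'.
Proof.
rewrite /wsum -big_split; apply: eq_bigr => a _; rewrite -big_split.
by apply: eq_bigr => b _; rewrite natrD mulrDr.
Qed.

Lemma le_wsum w S d d' : positive w ->
  {in S &, forall a b, d a b <= d' a b}%N -> wsum w S d <= wsum w S d'.
Proof.
move=> w0 dd'; apply: ler_sum => a aS; apply: ler_sum => b bS.
by rewrite ler_wpM2l ?ler_nat ?dd' // ltW.
Qed.

Lemma lt_wsum w S d d' a b : positive w ->
  {in S &, forall a b, d a b <= d' a b}%N -> a \in S -> b \in S ->
  (d a b < d' a b)%N -> wsum w S d < wsum w S d'.
Proof.
move=> w0 dd' aS bS dab.
have le_w i j : i \in S -> j \in S -> w i j * (d i j)%:R <= w i j * (d' i j)%:R.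
  by move=> iS jS; rewrite ler_wpM2l ?ler_nat ?dd' // ltW.
rewrite /wsum (bigD1 a) //= [X in _ < X](bigD1 a) //=.
apply: ltr_leD; last first.
  by apply: ler_sum => i /andP[iS _]; apply: ler_sum => j jS; apply: le_w.
rewrite (bigD1 b) //= [X in _ < X](bigD1 b) //=.
apply: ltr_leD; first by rewrite ltr_pM2l ?ltr_nat.
by apply: ler_sum => j /andP[jS _]; apply: le_w.
Qed.

Lemma wsum_eq_or_lt w S d d' : positive w ->
  {in S &, forall a b, d a b <= d' a b}%N ->
  {in S &, d =2 d'} \/ wsum w S d < wsum w S d'.
Proof.
move=> w0 dd'.
have [/existsP[a /existsP[b /and3P[aS bS dab]]]|none] :=
  boolP [exists a, exists b, [&& a \in S, b \in S & (d a b < d' a b)%N]].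
  by right; apply: lt_wsum aS bS dab.
left=> a b aS bS; apply/eqP; rewrite eqn_leq dd' //= leqNgt.
by apply: contraNN none => dab; apply/existsP; exists a; apply/existsP; exists b; apply/and3P.
Qed.

(** The two alternatives carry the equality case along: without a strict gain, all distances in [S]
    are those of the kite listed by [t]. *)
Definition dominated w S d := exists t : seq V, [/\ uniq t, t =i S &
  {in S &, d =2 seq_kite_dist t} \/ wsum w S d < wsum w S (seq_kite_dist t)].

Lemma dominated_lt w S d d' : wsum w S d < wsum w S d' -> dominated w S d' -> dominated w S d.
Proof.
move=> dd' [t [ut tS dt]]; exists t; split=> //; right.
by case: dt => [/eq_wsum <-//|]; apply: lt_trans.
Qed.

Lemma eq_dominated w S d d' : {in S &, d =2 d'} -> dominated w S d' -> dominated w S d.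
Proof.
move=> dd' [t [ut tS dt]]; exists t; split=> //.
case: dt => [dt|]; last by rewrite (eq_wsum _ dd'); right.
by left=> a b aS bS; rewrite dd' ?dt.
Qed.

(* [wsum_attach]: for distances [attach v u d], the vertex [v] may be merged into [u]. *)
Definition merge_weight (v u : V) w a b : R :=
  w a b + (a == u)%:R * w v b + (b == u)%:R * w a v.

Lemma positive_merge v u w : positive w -> positive (merge_weight v u w).
Proof.
move=> w0 a b; rewrite /merge_weight -addrA.
by apply: ltr_wpDr => //; apply: addr_ge0; rewrite mulr_ge0 ?ler0n // ltW.
Qed.

Lemma wsum_attach w S v u d : u \in S -> v \notin S ->
  wsum w (v |: S) (attach v u d) =
  wsum (merge_weight v u w) S d + \sum_(a in S) (w v a + w a v).
Proof.
move=> uS vS.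
have split_v (F : V -> R) : \sum_(a in v |: S) F a = F v + \sum_(a in S) F a.
  by rewrite big_setU1.
have neqv a : a \in S -> (a == v) = false.
  by move=> aS; apply/negbTE; apply: contraNneq vS => <-.
rewrite /wsum split_v split_v {1}/attach eqxx mulr0 add0r.
(* The distance from [v] to [b] is [d u b + 1]: the first term goes into the weights of [u], the 1
   into a sum independent of [d]. *)
under eq_bigr => b bS do rewrite /attach eqxx neqv // -natr1 mulrDr mulr1.
rewrite big_split /=.
under [X in _ + _ + X]eq_bigr => a aS.
  rewrite split_v {1}/attach neqv // eqxx -natr1 mulrDr mulr1.
  under eq_bigr => b bS do rewrite /attach !neqv //.
  over.
rewrite !big_split /= /merge_weight.
under [X in _ = X + _]eq_bigr => a aS.
  under eq_bigr => b bS do rewrite !mulrDl.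
  rewrite !big_split /=.
  rewrite -[X in _ + X + _]/(\sum_(b in S) _ * _ * _).
  under [X in _ + X + _]eq_bigr => b bS do rewrite -mulrA.
  rewrite -mulr_sumr.
  rewrite [X in _ + _ + X](bigD1 u) //= eqxx mul1r [X in _ + _ + (_ + X)]big1 ?addr0; last first.
    by move=> b /andP[_ /negbTE->]; rewrite !mul0r.
  over.
rewrite !big_split /= [X in _ = _ + X + _ + _](bigD1 u) //= eqxx mul1r.
rewrite [X in _ = _ + (_ + X) + _ + _]big1 ?addr0; last first.
  by move=> b /andP[_ /negbTE->]; rewrite !mul0r.
ring.
Qed.

End WeightedSums.

(** * Kites with a pendant vertex *)

Section AttachToKite.
Variables (R : realDomainType) (V : finType) (w : V -> V -> R).
Hypothesis w_gt0 : positive w.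
Implicit Types (S : {set V}) (d : V -> V -> nat) (s p : seq V).

Lemma wsum_convex S d0 d1 d2 a b :
    {in S &, forall a b, (d0 a b).*2 <= d1 a b + d2 a b}%N -> a \in S -> b \in S ->
    ((d0 a b).*2 < d1 a b + d2 a b)%N ->
  wsum w S d0 *+ 2 < wsum w S d1 + wsum w S d2.
Proof.
move=> le_d aS bS lt_d; rewrite mulr2n -!wsumD.
apply: (lt_wsum w_gt0 (a := a) (b := b)) => // [i j iS jS|]; rewrite addnn //.
exact: le_d.
Qed.

(** As the triangle slides along [p], the distances from [x] are convex in its position and the
    others constant. So an inner position is beaten by one of the two ends, where the graph is a
    kite. *)
Lemma join_dominated S (x : V) p i : uniq (x :: p) -> x :: p =i S ->
  (i.+1 < size p)%N -> dominated w S (join_dist i x p).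
Proof.
move=> /[dup] uxp /andP[xp up] pS size_i.
have size_p : (1 < size p)%N by lia.
have first : dominated w S (join_dist 0 x p).
  exists (x :: p); split=> //; left=> a b; rewrite -!pS; exact: join_dist_first.
have last : dominated w S (join_dist (size p - 2) x p).
  exists (x :: rev p); split; first by rewrite /= mem_rev xp rev_uniq.
    by move=> a; rewrite -pS !inE mem_rev.
  by left=> a b; rewrite -!pS; exact: join_dist_last.
have [->//|i_gt0] := posnP i; have [->//|i_neq] := eqVneq i (size p - 2)%N.
have cvx k : (0 < k < size p - 2)%N -> wsum w S (join_dist k x p) *+ 2 <
    wsum w S (join_dist k.-1 x p) + wsum w S (join_dist k.+1 x p).
  move=> hk; have lt_k : (k < size p)%N by lia.
  have kp : nth x p k \in p by apply: mem_nth.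
  apply: (wsum_convex (a := x) (b := nth x p k)).
  - move=> a b _ _; rewrite /join_dist /path_dist.
    by case: eqP => _; case: eqP => _; lia.
  - by rewrite -pS mem_head.
  - by rewrite -pS inE kp orbT.
  - rewrite /join_dist eqxx; case: eqP => [eq_x|_]; first by rewrite -eq_x kp in xp.
    by rewrite index_uniq //; lia.
by have [lt_W|lt_W] := strict_convex_lt_ends cvx (i := i) ltac:(lia);
  apply: (dominated_lt lt_W).
Qed.

(* With [v] attached to the vertex of index 1, the graph is also the path obtained by putting [v]
   in place of the first vertex [x] of [s], with [x] joined to indices 1 and 2. *)
Lemma attach_kite_dominated S s (v u : V) : uniq (v :: s) -> v :: s =i S ->
  u \in s -> (2 < size s)%N -> dominated w S (attach v u (seq_kite_dist s)).
Proof.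
move=> /[dup] uvs /andP[vs us] vsS.
wlog u_pos : s uvs vs us vsS / (0 < index u s)%N => [IH|] u_s size_s.
  have [idx0|idx_pos] := posnP (index u s); last exact: IH.
  case: s idx0 uvs vs us vsS u_s size_s => [|x [|y s]] //=; case: (eqVneq x u) => // -> _.
  move=> uvs vs us vsS _ size_s.
  have uy : u != y by move: us; rewrite /= inE negb_or => /andP[/andP[]].
  have cons_swap : v :: y :: u :: s =i v :: u :: y :: s.
    by move=> a; rewrite !inE [(a == y) || _]orbCA.
  apply: (@eq_dominated _ _ _ _ _ (attach v u (seq_kite_dist [:: y, u & s]))).
    by move=> a b _ _; rewrite /attach !(seq_kite_dist_swap _ uy).
  have uvs' : uniq [:: v, y, u & s].
    by rewrite (perm_uniq (_ : perm_eq _ [:: v, u, y & s])) // perm_cons (perm_catCA [:: y] [:: u]).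
  have /= /andP[vs' us'] := uvs'.
  apply: IH => //; [by move=> a; rewrite cons_swap vsS| |by rewrite !inE eqxx orbT].
  by rewrite /= eq_sym (negbTE uy).
(* Convexity fails at [k = 1], because indices 0 and 1 are equally far from all later vertices; so
   index 1 serves as an end of the range. *)
have cvx k : (1 < k < (size s).-1)%N ->
    wsum w S (attach v (nth v s k) (seq_kite_dist s)) *+ 2 <
    wsum w S (attach v (nth v s k.-1) (seq_kite_dist s)) +
    wsum w S (attach v (nth v s k.+1) (seq_kite_dist s)).
  move=> hk.
  have nth_s i : (i < size s)%N -> nth v s i \in s by apply: mem_nth.
  have nth_i i : (i < size s)%N -> index (nth v s i) s = i by move=> ?; rewrite index_uniq.
  apply: (wsum_convex (a := v) (b := nth v s k)).
  - move=> a b _ _; rewrite /attach /seq_kite_dist !nth_i; [|lia..].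
    by rewrite /kite_dist /path_dist; case: eqP => _; case: eqP => _; lia.
  - by rewrite -vsS mem_head.
  - by rewrite -vsS inE nth_s ?orbT //; lia.
  - rewrite /attach eqxx; case: eqP => [eq_v|_].
      by move: (nth_s k ltac:(lia)); rewrite eq_v (negbTE vs).
    by rewrite /seq_kite_dist !nth_i /kite_dist /path_dist; lia.
have first : dominated w S (attach v (nth v s 1) (seq_kite_dist s)).
  case: s {u_pos u_s cvx} uvs vs us vsS size_s => [|x [|y s]] // uvs vs us vsS size_s.
  have perm_s : perm_eq [:: x, v, y & s] [:: v, x, y & s] by rewrite (perm_catCA [:: x] [:: v]).
  have vs_mem := perm_mem perm_s.
  apply: (@eq_dominated _ _ _ _ _ (join_dist 1 x [:: v, y & s])); last first.
    by apply: join_dominated => //; [rewrite (perm_uniq perm_s)|move=> a; rewrite -vsS].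
  have [vx xy] : v != x /\ x != y.
    by move: vs us; rewrite /= !inE !negb_or => /andP[-> _] /andP[/andP[->]].
  have xv : x != v by rewrite eq_sym.
  move=> a b _ _; rewrite /attach /join_dist /seq_kite_dist /= eqxx (negbTE xy).
  rewrite ![v == _]eq_sym ![x == _]eq_sym.
  case: (eqVneq a v) => [->|_]; case: (eqVneq b v) => [->|_]; rewrite ?(negbTE vx);
    do ?[case: (eqVneq _ x) => _]; rewrite /kite_dist /path_dist; do ?case: ifP => _; lia.
have last : dominated w S (attach v (nth v s (size s).-1) (seq_kite_dist s)).
  exists (rcons s v); split; first by rewrite rcons_uniq vs.
    by move=> a; rewrite mem_rcons -vsS.
  by left=> a b; rewrite -!vsS nth_last; exact: attach_last.
rewrite -(nth_index v u_s); move: u_s; rewrite -index_mem; move: (index u s) u_pos => i i_pos i_s.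
have [<-//|i_neq1] := eqVneq 1%N i.
have [->//|i_neq] := eqVneq i (size s).-1.
have i_mid : (1 < i < (size s).-1)%N.
  by move: (size s) i_pos i_s i_neq i_neq1 => m; lia.
by have [lt_W|lt_W] := strict_convex_lt_ends cvx i_mid; apply: (dominated_lt lt_W).
Qed.

End AttachToKite.

(** * Odd cycles and new vertices *)

Section Domination.
Variables (R : realDomainType) (V : finType).
Implicit Types (w : V -> V -> R) (S : {set V}) (d : V -> V -> nat).

(** Making [v] pendant at [u] lowers no distance, and merging [v] into [u] then leaves the problem
    on [S]. As merging changes the weights, the assumption on [S] ranges over all positive
    weights. *)
Lemma dominated_setU1 w S (v u : V) d :
    (forall w', positive w' -> dominated w' S d) -> positive w ->
    u \in S -> v \notin S -> (2 < #|S|)%N -> (forall a b, d a b = d b a) -> d v v = 0%N ->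
    (forall b, d v b <= (d u b).+1)%N ->
  dominated w (v |: S) d.
Proof.
move=> IH w0 uS vS cardS dC dvv d_vu.
have le_attach : {in v |: S &, forall a b, d a b <= attach v u d a b}%N.
  move=> a b _ _; rewrite /attach; case: (eqVneq a v) => [->|_]; last first.
    by case: eqP => [->|//]; rewrite dC (dC a).
  by case: (eqVneq b v) => [->|_ //]; rewrite dvv.
have [t [ut tS dt]] := IH _ (positive_merge v u w0).
have dom_t : dominated w (v |: S) (attach v u (seq_kite_dist t)).
  apply: attach_kite_dominated => //; rewrite ?tS //=.
  - by rewrite tS vS ut.
  - by move=> a; rewrite !inE tS.
  - by rewrite -(card_uniqP ut) (eq_card tS).
case: dt => [eq_dt|lt_dt]; last first.
  apply: dominated_lt dom_t; apply: le_lt_trans (le_wsum w0 le_attach) _.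
  by rewrite !wsum_attach // ltrD2r.
have eq_attach : {in v |: S &, attach v u d =2 attach v u (seq_kite_dist t)}.
  move=> a b; rewrite !inE /attach; case: eqP => _ /= aS; case: eqP => _ /= bS //;
    by rewrite eq_dt.
have dom : dominated w (v |: S) (attach v u d) by apply: eq_dominated dom_t.
by have [/eq_dominated|/dominated_lt] := wsum_eq_or_lt w0 le_attach; apply.
Qed.

Lemma wsum_sum w S (I : Type) (r : seq I) (F : I -> V -> V -> nat) :
  wsum w S (fun a b => \sum_(i <- r) F i a b)%N = \sum_(i <- r) wsum w S (F i).
Proof.
rewrite /wsum [RHS]exchange_big; apply: eq_bigr => a _; rewrite [RHS]exchange_big.
by apply: eq_bigr => b _; rewrite natr_sum mulr_sumr.
Qed.

Lemma wsumMn w S d n : wsum w S (fun a b => n * d a b)%N = n%:R * wsum w S d.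
Proof.
rewrite /wsum mulr_sumr; apply: eq_bigr => a _; rewrite mulr_sumr.
by apply: eq_bigr => b _; rewrite natrM mulrCA.
Qed.

Section CycleDistances.
Variables (e : rel V) (d : V -> V -> nat) (c : seq V).
Hypotheses (e_sym : symmetric e) (cyc_c : cycle e c) (uniq_c : uniq c).
Hypotheses (dC : forall a b, d a b = d b a) (dxx : forall a, d a a = 0%N).
Hypothesis d_lipschitz : forall a b y, e a b -> (d a y <= (d b y).+1)%N.

Lemma cycle_dist_le x0 i j : (i <= j < size c)%N ->
  (d (nth x0 c i) (nth x0 c j) <= minn (j - i) (size c - (j - i)))%N.
Proof.
have [n size_c] : exists n, size c = n.+1 \/ c = [::].
  by case: (c) => [|x p]; [exists 0%N; right|exists (size p); left].
case: size_c => [size_c|-> /= /andP[_]]; last by rewrite ltn0.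
have step k : (k < n)%N -> e (nth x0 c k) (nth x0 c k.+1).
  move=> kn; case: c size_c cyc_c => //= x p [size_p] /(pathP x0) /(_ k).
  rewrite size_rcons size_p nth_rcons -rcons_cons nth_rcons /= size_p kn (leq_trans kn) //.
  by apply; lia.
have back : e (nth x0 c n) (nth x0 c 0).
  case: c size_c cyc_c => //= x p [size_p] /(pathP x0) /(_ n).
  rewrite size_rcons size_p ltnS leqnn -rcons_cons !nth_rcons /= size_p ltnn eqxx leqnn.
  by apply.
have fwd k l : (k + l <= n)%N -> (d (nth x0 c k) (nth x0 c (k + l)) <= l)%N.
  elim: l => [|l IH] kl; first by rewrite addn0 dxx.
  rewrite dC addnS; apply: leq_trans (d_lipschitz _ _) _.
    by rewrite e_sym; apply: step; lia.
  by rewrite dC ltnS; apply: IH; lia.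
have bwd k l : (k + l <= n)%N -> (d (nth x0 c k) (nth x0 c (n - l)) <= k + l.+1)%N.
  elim: l => [|l IH] kl.
    rewrite subn0 dC; apply: leq_trans (d_lipschitz _ back) _.
    by rewrite addn1 ltnS; apply: (fwd 0%N k); lia.
  rewrite dC; apply: leq_trans (d_lipschitz _ _) _.
    by apply: (step (n - l.+1)%N); lia.
  rewrite addnS ltnS dC (_ : (n - l.+1).+1 = n - l)%N; last by lia.
  by apply: IH; lia.
rewrite size_c => /andP[ij jn]; rewrite leq_min; apply/andP; split.
  by rewrite -{1}(subnKC ij); apply: fwd; lia.
have := bwd i (n - j)%N; rewrite subKn; last by lia.
by move=> /(_ ltac:(lia)) /leq_trans; apply; lia.
Qed.

Lemma cycle_dominated w S : positive w -> c =i S -> (2 < size c)%N -> odd (size c) ->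
  dominated w S d.
Proof.
move=> w0 cS size_c odd_c.
have kite_rot r : uniq (rot r c) /\ rot r c =i S.
  by split=> [|a]; rewrite ?rot_uniq // mem_rot cS.
have x0 : V by case: (c) size_c => [|x0].
have index_nth a : a \in S -> exists2 i, (i < size c)%N & a = nth x0 c i.
  by rewrite -cS => ac; exists (index a c); rewrite ?index_mem ?nth_index.
have nth_index i : (i < size c)%N -> index (nth x0 c i) c = i by move=> ?; rewrite index_uniq.
(* A triangle is itself a kite, and the strict gain by averaging used for longer cycles is absent
   there. *)
have [size_c3|size_c5] := leqP (size c) 3.
  have size3 : size c = 3 by lia.
  have [//|lt_d|eq_d] := @wsum_eq_or_lt _ _ w S d (seq_kite_dist c) w0.
  - move=> a b /index_nth[i ic ->] /index_nth[j jc ->]; rewrite /seq_kite_dist !nth_index //.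
    wlog ij : i j ic jc / (i <= j)%N => [IH|].
      by have [/IH->//|/ltnW /IH] := leqP i j; rewrite dC kite_distC; apply.
    apply: leq_trans (cycle_dist_le x0 (i := i) (j := j) _) _; first by rewrite ij.
    by rewrite size3 /kite_dist /path_dist; lia.
  - by exists c; have [] := kite_rot 0%N; rewrite rot0; split=> //; left.
  - by exists c; have [] := kite_rot 0%N; rewrite rot0; split=> //; right.
pose D a b := (\sum_(0 <= r < size c) seq_kite_dist (rot r c) a b)%N.
have D_nth i j : (i < size c)%N -> (j < size c)%N -> D (nth x0 c i) (nth x0 c j) =
    (\sum_(0 <= r < size c) kite_dist (rot_pos (size c) r i) (rot_pos (size c) r j))%N.
  move=> ic jc; rewrite /D big_nat [RHS]big_nat; apply: eq_bigr => r /= rc.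
  by rewrite /seq_kite_dist !index_rot ?mem_nth // !nth_index.
have le_D : {in S &, forall a b, size c * d a b <= D a b}%N.
  move=> a b /index_nth[i ic ->] /index_nth[j jc ->].
  wlog ij : i j ic jc / (i <= j)%N => [IH|].
    have [/IH->//|/ltnW /IH] := leqP i j; rewrite dC D_nth // D_nth //.
    by under eq_bigr => r _ do rewrite kite_distC; apply.
  have [->|i_j] := eqVneq i j; first by rewrite dxx muln0.
  have lt_ij : (i < j)%N by lia.
  have := @sum_rot_kite_dist (size c) i j; rewrite lt_ij jc -D_nth // => /(_ isT).
  have := cycle_dist_le x0 (i := i) (j := j); rewrite ij jc => /(_ isT).
  move: (d _ _) (D _ _) => x y.
  have [t jE] : exists t, j = (i + t.+1)%N by exists (j - i.+1)%N; lia.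
  have [k nE] : exists k, size c = (j + k.+1)%N by exists (size c - j.+1)%N; lia.
  move: odd_c size_c5; rewrite nE jE.
  rewrite (_ : i + t.+1 + k.+1 - (i + t.+1 - i) = i + k.+1)%N; last by lia.
  rewrite (_ : i + t.+1 - i = t.+1)%N; last by lia.
  rewrite (_ : i + t.+1 + k.+1 = t.+1 + (i + k.+1))%N; last by lia.
  by move=> *; apply: odd_split_le; rewrite // addnS.
(* For neighbours the sum over rotations is at least [2 (size c - 1) - 2], which exceeds [size c]
   from length 5 on. *)
have lt_D : (size c * d (nth x0 c 0) (nth x0 c 1) < D (nth x0 c 0) (nth x0 c 1))%N.
  have := @sum_rot_kite_dist (size c) 0 1; rewrite -D_nth; try lia; move=> /(_ ltac:(lia)).
  have := cycle_dist_le x0 (i := 0%N) (j := 1%N) ltac:(lia).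
  rewrite !subn0 !mul1n; move: (d _ _) (D _ _) => x y.
  rewrite leq_min => /andP[x1 _] yn.
  suff : (size c * x <= size c * 1)%N by lia.
  by rewrite leq_mul2l x1 orbT.
have nth_S k : (k < size c)%N -> nth x0 c k \in S by move=> kc; rewrite -cS mem_nth.
have := lt_wsum w0 le_D (nth_S 0%N ltac:(lia)) (nth_S 1%N ltac:(lia)) lt_D.
rewrite wsumMn wsum_sum => lt_sum.
(* The sum for [d] lies strictly below the average over the rotations, hence below the sum for one
   of them. *)
have [/hasP[r _ lt_r]|/hasPn none] :=
  boolP (has (fun r => wsum w S d < wsum w S (seq_kite_dist (rot r c))) (index_iota 0 (size c))).
  by exists (rot r c); have [] := kite_rot r; split=> //; right.
suff : \sum_(0 <= r < size c) wsum w S (seq_kite_dist (rot r c)) <= (size c)%:R * wsum w S d.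
  by move=> /(lt_le_trans lt_sum); rewrite ltxx.
rewrite -[size c in X in _ <= X]subn0 mulr_natl -sumr_const_nat !big_seq; apply: ler_sum => r /none.
by rewrite -leNgt.
Qed.

End CycleDistances.

End Domination.

(** * Graph distance *)

Lemma bigminn_le (I : eqType) (r : seq I) (P : pred I) (F : I -> nat) m j :
  j \in r -> P j -> (\big[minn/m]_(i <- r | P i) F i <= F j)%N.
Proof.
elim: r => [|i r IH] //=; rewrite inE big_cons => /orP[/eqP<- ->|j_r Pj]; first exact: geq_minl.
by case: ifP => _; rewrite ?geq_min IH ?orbT.
Qed.

Section GraphDistance.
Variable G : sgraph.
Implicit Types (u v : G) (p : seq G).

Lemma gdist_le_card u v : (gdist u v <= #|G|)%N.
Proof.
rewrite /gdist; elim/big_rec: _ => // k m _ le_m.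
by apply: leq_trans le_m; apply: geq_minr.
Qed.

Lemma gdist_le_path u p : path (@adj G) u p -> (gdist u (last u p) <= size p)%N.
Proof.
case/shortenP => q path_q uniq_q sub_q.
have le_size : (size q <= size p)%N.
  by apply: uniq_leq_size => //; case/andP: uniq_q.
have size_q : (size q < #|G|)%N.
  by have := max_card [in u :: q]; rewrite (card_uniqP uniq_q).
apply: leq_trans le_size; apply: (@bigminn_le _ _ _ _ _ (Ordinal size_q)).
  exact: mem_index_enum.
by apply/existsP; exists (in_tuple q); apply/and3P.
Qed.

(** The default value is a separate case; as it bounds every distance, that case is immediate for
    symmetry and the Lipschitz bound. *)
Lemma gdistP u v : gdist u v = #|G| \/
  exists p, [/\ path (@adj G) u p, last u p = v & gdist u v = size p].
Proof.
rewrite /gdist; elim/big_rec: _ => [|k m /existsP[p /and3P[path_p _ /eqP last_p]] IH].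
  by left.
have [_|_] := leqP k m; last by [].
by right; exists p; rewrite size_tuple.
Qed.

Lemma gdistxx u : gdist u u = 0%N.
Proof. by apply/eqP; rewrite -leqn0; apply: (@gdist_le_path u [::]). Qed.

Lemma gdistC u v : gdist u v = gdist v u.
Proof.
suff le_gdist (a b : G) : (gdist a b <= gdist b a)%N by apply/eqP; rewrite eqn_leq !le_gdist.
have [->|[p [path_p last_p ->]]] := gdistP b a; first exact: gdist_le_card.
have := @gdist_le_path (last b p) (rev (belast b p)).
rewrite rev_path size_rev size_belast.
rewrite (eq_path (fun x y => adj_sym y x)) => /(_ path_p).
rewrite last_p; congr (gdist _ _ <= _)%N.
by case: (p) last_p => [<-//|c q] _; rewrite /= rev_cons last_rcons.
Qed.

Lemma gdist_lipschitz u v y : adj u v -> (gdist u y <= (gdist v y).+1)%N.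
Proof.
move=> uv; have [->|[p [path_p last_p ->]]] := gdistP v y.
  exact: leqW (gdist_le_card _ _).
by rewrite -last_p; apply: (@gdist_le_path u (v :: p)); rewrite /= uv.
Qed.

Lemma gdist_gt0 u v : u != v -> (0 < gdist u v)%N.
Proof.
move=> uv; have [->|[[|x p] [_ /= last_p ->]]] := gdistP u v; last by [].
  by apply/card_gt0P; exists u.
by rewrite last_p eqxx in uv.
Qed.

Lemma adj_gdist u v : adj u v = (gdist u v == 1%N).
Proof.
have [<-|uv] := eqVneq u v; first by rewrite adj_irr gdistxx.
apply/idP/eqP => [adj_uv|dist1].
  by apply/eqP; rewrite eqn_leq gdist_gt0 // andbT -(gdistxx v) gdist_lipschitz.
have [card1|[p [path_p last_p]]] := gdistP u v.
  have : (#|[set u; v]| <= #|G|)%N by apply: max_card.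
  by rewrite cards2 uv -card1 dist1.
by case: p path_p last_p => [|x [|]] //=; rewrite ?dist1 // andbT => ux <-.
Qed.

(** Lower bounds on distances come from a potential that drops by at most 1 along each edge; the
    bound by [#|G|] covers the default value. *)
Lemma le_gdist_lipschitz (f : G -> nat) u v : (f u <= #|G|)%N -> f v = 0%N ->
  (forall a b, adj a b -> f a <= (f b).+1)%N -> (f u <= gdist u v)%N.
Proof.
move=> f_card f_v f_lip; have [->//|[p [path_p last_p ->]]] := gdistP u v.
suff : (f u <= f (last u p) + size p)%N by rewrite last_p f_v.
elim: p u path_p {last_p f_card} => [|x p IH] u /=; first by rewrite addn0.
by case/andP=> /f_lip/leq_trans + /IH le_x; apply; rewrite addnS ltnS.
Qed.

Lemma exists_cut_edge (S : {set G}) u v : connected_graph G -> u \in S -> v \notin S ->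
  exists a b, [/\ a \in S, b \notin S & adj a b].
Proof.
move=> conn uS vS.
have [/existsP[a /existsP[b /and3P[]]]|none] :=
  boolP [exists a, exists b, [&& a \in S, b \notin S & adj a b]]; first by exists a, b.
have closed_S : closed (@adj G) (mem S).
  apply: intro_closed => [|a b ab aS]; first exact: sym_connect_sym (@adj_sym G).
  apply: contraNT none => bS; apply/existsP; exists a; apply/existsP; exists b.
  by apply/and3P.
by have := closed_connect closed_S (conn u v); rewrite /= uS (negbTE vS).
Qed.

Lemma gdist_dominated (R : realDomainType) (w : G -> G -> R) :
  unicyclic_odd G -> positive w -> dominated w [set: G] (@gdist G).
Proof.
move=> [conn [c [/and3P[size_c uniq_c cyc_c] odd_c _]]].
(* [S] grows from the cycle to all of [G] through edges leaving it; the distances are always those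
   of the whole graph. *)
have extend m (S : {set G}) : #|~: S| = m -> (2 < #|S|)%N ->
    (forall w' : G -> G -> R, positive w' -> dominated w' S (@gdist G)) ->
    forall w' : G -> G -> R, positive w' -> dominated w' [set: G] (@gdist G).
  elim: m S => [|m IH] S cardC cardS domS w' w'0.
    suff -> : [set: G] = S by apply: domS.
    by apply/esym/eqP; rewrite eqEcard finset.subsetT cardsT -(cardsC S) cardC addn0 leqnn.
  have [v vS] : exists v, v \notin S.
    have /card_gt0P[v] : (0 < #|~: S|)%N by rewrite cardC.
    by rewrite inE => vS; exists v.
  have [u uS] : exists u, u \in S by apply/card_gt0P; lia.
  have [a [b [aS bS ab]]] := exists_cut_edge conn uS vS.
  apply: (IH (b |: S)) w' w'0.
  - by have := cardsC S; have := cardsC (b |: S); rewrite cardsU1 bS; lia.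
  - by rewrite cardsU1 bS; lia.
  move=> w' w'0; apply: (dominated_setU1 (u := a)) => //; first exact: gdistC.
    exact: gdistxx.
  by move=> y; apply: gdist_lipschitz; rewrite adj_sym.
move=> w0; apply: (extend _ [set x in c] erefl _ _ w w0).
  by rewrite cardsE (card_uniqP uniq_c).
move=> w' w'0; apply: (@cycle_dominated _ _ (@adj G) _ c) => //.
- exact: adj_sym.
- exact: gdistC.
- exact: gdistxx.
- exact: gdist_lipschitz.
- by move=> x; rewrite inE.
Qed.

End GraphDistance.

Lemma le_gdist_iso (G H : sgraph) (f : G -> H) (u v : G) : #|G| = #|H| ->
  (forall x y, adj (f x) (f y) = adj x y) -> (gdist (f u) (f v) <= gdist u v)%N.
Proof.
move=> cardE f_adj; have [->|[p [path_p last_p ->]]] := gdistP u v.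
  by rewrite cardE gdist_le_card.
rewrite -last_p -last_map -(size_map f); apply: gdist_le_path.
rewrite path_map; apply: sub_path path_p => x y.
by rewrite /= f_adj.
Qed.

Lemma kite_adjE n (i j : kite n) : adj i j = (kite_dist i j == 1%N).
Proof. by rewrite /= /kite_adj -val_eqE /kite_dist /path_dist /=; lia. Qed.

(** This direction is the one used: weighted sums of [kite_dist] have to stay below those of the
    true distances in the kite. *)
Lemma kite_dist_le_gdist n (i j : kite n) : (kite_dist i j <= gdist i j)%N.
Proof.
apply: (@le_gdist_lipschitz _ (fun k : kite n => kite_dist k j)).
- have := ltn_ord i; have := ltn_ord j; rewrite card_ord /kite_dist /path_dist; lia.
- exact: kite_distxx.
by move=> a b; rewrite kite_adjE /kite_dist /path_dist; lia.
Qed.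

(** * Largest eigenvalue of a symmetric matrix *)

Section TopEigenvalue.
Variable R : realType.

Definition bilin n (B : 'M[R]_n) (x y : 'rV[R]_n) : R := (x *m B *m y^T) 0 0.

Section Bilinear.
Variables (n : nat) (B : 'M[R]_n).
Implicit Types (x y z : 'rV[R]_n).

Lemma bilinE x y : bilin B x y = \sum_i \sum_j x 0 i * B i j * y 0 j.
Proof.
rewrite /bilin !mxE exchange_big; apply: eq_bigr => j _.
by rewrite !mxE mulr_suml.
Qed.

Lemma bilinDl x y z : bilin B (x + y) z = bilin B x z + bilin B y z.
Proof. by rewrite /bilin !mulmxDl mxE. Qed.

Lemma bilinDr x y z : bilin B z (x + y) = bilin B z x + bilin B z y.
Proof. by rewrite /bilin linearD mulmxDr mxE. Qed.

Lemma bilinZl a x z : bilin B (a *: x) z = a * bilin B x z.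
Proof. by rewrite /bilin -!scalemxAl mxE. Qed.

Lemma bilinZr a x z : bilin B z (a *: x) = a * bilin B z x.
Proof. by rewrite /bilin linearZ -scalemxAr mxE. Qed.

Lemma bilinC x y : B^T = B -> bilin B x y = bilin B y x.
Proof.
move=> B_sym; rewrite /bilin.
have -> : y *m B *m x^T = (x *m B *m y^T)^T by rewrite !trmx_mul B_sym trmxK mulmxA.
by rewrite [RHS]mxE.
Qed.

Definition sqnorm x : R := \sum_i x 0 i ^+ 2.

Lemma sqnormE x : sqnorm x = (x *m x^T) 0 0.
Proof. by rewrite mxE; apply: eq_bigr => i _; rewrite mxE expr2. Qed.

Lemma sqnorm_ge0 x : 0 <= sqnorm x.
Proof. by apply: sumr_ge0 => i _; apply: sqr_ge0. Qed.

Lemma sqnorm_eq0 x : sqnorm x = 0 -> x = 0.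
Proof.
move/eqP; rewrite psumr_eq0 => [/allP x0|i _]; last exact: sqr_ge0.
by apply/rowP => i; have := x0 i (mem_index_enum i); rewrite sqrf_eq0 mxE => /eqP.
Qed.

Lemma sqnorm_gt0 x : x != 0 -> 0 < sqnorm x.
Proof. by move=> x0; rewrite lt_def sqnorm_ge0 andbT; apply: contraNneq x0 => /sqnorm_eq0->. Qed.

Lemma bilin_bounded : exists2 C : R, 0 < C & forall x, bilin B x x <= C * sqnorm x.
Proof.
(* Each product of two entries of [x] is bounded by [sqnorm x]; the 1 keeps the constant positive
   when [B] is zero. *)
exists (1 + \sum_i \sum_j `|B i j|) => [|x].
  by apply: ltr_wpDr => //; apply: sumr_ge0 => i _; apply: sumr_ge0.
rewrite bilinE mulrDl mul1r; apply: ler_wpDl (sqnorm_ge0 x) _.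
rewrite mulr_suml; apply: ler_sum => i _; rewrite mulr_suml; apply: ler_sum => j _.
have le_sq k : x 0 k ^+ 2 <= sqnorm x.
  by rewrite /sqnorm (bigD1 k) //= lerDl; apply: sumr_ge0 => ? _; apply: sqr_ge0.
apply: le_trans (ler_norm _) _; rewrite mulrAC normrM mulrC ler_wpM2l //.
have := le_sq i; have := le_sq j; have := sqr_ge0 (x 0 i - x 0 j); have := sqr_ge0 (x 0 i + x 0 j).
rewrite ler_norml; move: (x 0 i) (x 0 j) (sqnorm x) => a b s ? ? ? ?.
by apply/andP; split; nra.
Qed.

End Bilinear.

Section PositiveSemidefinite.
Variables (n : nat) (B : 'M[R]_n).
Implicit Types (x y z : 'rV[R]_n).
Hypotheses (B_sym : B^T = B) (B_ge0 : forall x, 0 <= bilin B x x).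

Lemma psd_expand x y t :
  0 <= bilin B x x - 2 * t * bilin B x y + t ^+ 2 * bilin B y y.
Proof.
have := B_ge0 (x + (- t) *: y).
rewrite bilinDl !bilinDr !bilinZl !bilinZr (bilinC y x B_sym); nra.
Qed.

Lemma psd_kernel z : bilin B z z = 0 -> z *m B = 0.
Proof.
move=> zBz; have [C C_gt0 le_C] := bilin_bounded B.
apply: sqnorm_eq0; apply/eqP; rewrite eq_le sqnorm_ge0 andbT.
(* At [z - t z B] the form is at most [(C t ^ 2 - 2 t) * sqnorm (z *m B)], which is negative for
   [t = C^-1] unless [z B = 0]. *)
have := psd_expand z (z *m B) C^-1.
have -> : bilin B z (z *m B) = sqnorm (z *m B) by rewrite /bilin sqnormE.
rewrite zBz => h.
have : C^-1 ^+ 2 * bilin B (z *m B) (z *m B) <= C^-1 * sqnorm (z *m B).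
  rewrite expr2 -mulrA ler_pM2l ?invr_gt0 // mulrC ler_pdivrMr // mulrC; exact: le_C.
have : 0 < C^-1 by rewrite invr_gt0.
by rewrite leNgt => Ci ?; apply/negP => ?; nra.
Qed.

(* If [B] were invertible, expanding the form at [x - t x B^-1] for a small [t] would bound it below
   by a positive multiple of the norm. *)
Lemma psd_unit_coercive : B \in unitmx ->
  exists2 e : R, 0 < e & forall x, e * sqnorm x <= bilin B x x.
Proof.
move=> B_unit; have [C C_gt0 le_C] : exists2 C : R, 0 < C &
    forall x, bilin B (x *m invmx B) (x *m invmx B) <= C * sqnorm x.
  have [C C_gt0 le_C] := bilin_bounded (invmx B)^T; exists C => // x.
  by rewrite /bilin trmx_mul mulmxA mulmxKV //; apply: le_C.
exists C^-1 => [|x]; first by rewrite invr_gt0.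
have := psd_expand x (x *m invmx B) C^-1.
have -> : bilin B x (x *m invmx B) = sqnorm x.
  by rewrite (bilinC _ _ B_sym) /bilin mulmxKV // sqnormE.
have : C^-1 ^+ 2 * bilin B (x *m invmx B) (x *m invmx B) <= C^-1 * sqnorm x.
  rewrite expr2 -mulrA ler_pM2l ?invr_gt0 // mulrC ler_pdivrMr // mulrC; exact: le_C.
lra.
Qed.

End PositiveSemidefinite.

(** Let [s] be the supremum of the Rayleigh quotients. Then [s I - A] is positive semidefinite, and
    singular, since coercivity would lower [s]. So [s] is an eigenvalue, and no eigenvalue exceeds
    it. *)
Lemma top_eigenvalue n (A : 'M[R]_n) (M := sup [set a | eigenvalue A a]%classic) :
    A^T = A -> (0 < n)%N ->
  [/\ forall x, bilin A x x <= M * sqnorm x,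
      forall x, bilin A x x = M * sqnorm x -> x *m A = M *: x &
      exists2 x : 'rV[R]_n, x != 0 & x *m A = M *: x].
Proof.
move=> A_sym n_gt0; have [C C_gt0 le_C] := bilin_bounded A.
pose E : set R := [set r | exists2 x : 'rV[R]_n, x != 0 & r = bilin A x x / sqnorm x]%classic.
have one_neq0 : const_mx 1 != 0 :> 'rV[R]_n.
  by apply/eqP => /matrixP/(_ 0 (Ordinal n_gt0)); rewrite !mxE; apply/eqP; rewrite oner_eq0.
have E_sup : has_sup E.
  split; first by eexists; exists (const_mx 1).
  by exists C => r [x x0 ->]; rewrite ler_pdivrMr ?sqnorm_gt0.
have bilinI_sub m x : bilin (m%:M - A) x x = m * sqnorm x - bilin A x x.
  rewrite /bilin sqnormE mulmxBr mulmxBl mul_mx_scalar -scalemxAl [LHS]mxE.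
  by congr (_ + _); rewrite [LHS]mxE.
have bilin0 : bilin A 0 0 = 0 by rewrite /bilin !mul0mx mxE.
have sqnorm0 : sqnorm (0 : 'rV[R]_n) = 0 by rewrite sqnormE mul0mx mxE.
have le_supE x : bilin A x x <= sup E * sqnorm x.
  have [->|x0] := eqVneq x 0; first by rewrite bilin0 sqnorm0 mulr0.
  by rewrite -ler_pdivrMr ?sqnorm_gt0 //; apply: ub_le_sup; [case: E_sup | exists x].
pose B := (sup E)%:M - A.
have B_sym : B^T = B by rewrite /B linearB /= tr_scalar_mx A_sym.
have B_ge0 x : 0 <= bilin B x x by rewrite bilinI_sub subr_ge0.
have eigen_of_kernel x : x *m B = 0 -> x *m A = sup E *: x.
  by rewrite mulmxBr mul_mx_scalar => /eqP; rewrite subr_eq0 eq_sym => /eqP.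
have [x x0 xA] : exists2 x : 'rV[R]_n, x != 0 & x *m A = sup E *: x.
  have [/(psd_unit_coercive B_sym B_ge0)[e e_gt0 le_e]|] := boolP (B \in unitmx).
    have : sup E <= sup E - e.
      apply: ge_sup; first by case: E_sup.
      move=> r [x x0 ->]; rewrite ler_pdivrMr ?sqnorm_gt0 // mulrBl.
      by have := le_e x; rewrite bilinI_sub; lra.
    lra.
  rewrite unitmxE unitfE negbK => /det0P[x x0 xB]; exists x => //.
  exact: eigen_of_kernel.
have ME : M = sup E.
  apply/eqP; rewrite eq_le; apply/andP; split.
    apply: ge_sup; first by exists (sup E); apply/eigenvalueP; exists x.
    move=> a /eigenvalueP[y yA y0]; have := le_supE y.
    by rewrite {1}/bilin yA -scalemxAl mxE -sqnormE ler_pM2r ?sqnorm_gt0.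
  apply: ub_le_sup; last by apply/eigenvalueP; exists x.
  exists (sup E) => a /eigenvalueP[y yA y0]; have := le_supE y.
  by rewrite {1}/bilin yA -scalemxAl mxE -sqnormE ler_pM2r ?sqnorm_gt0.
rewrite ME; split=> //; last by exists x.
move=> z zA; apply: eigen_of_kernel; apply: psd_kernel => //.
by rewrite bilinI_sub zA subrr.
Qed.

(** Taking absolute values in a top eigenvector does not lower the form, so the result is again a
    top eigenvector. A zero entry would force all others to vanish, the off-diagonal entries of [A]
    being positive. *)
Lemma perron_vector n (A : 'M[R]_n) (M := sup [set a | eigenvalue A a]%classic) :
    A^T = A -> (1 < n)%N -> (forall i j, 0 <= A i j) -> (forall i j, i != j -> 0 < A i j) ->
  exists2 z : 'rV[R]_n, forall i, 0 < z 0 i & bilin A z z = M * sqnorm z.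
Proof.
move=> A_sym n_gt1 A_ge0 A_gt0.
have [le_M eq_M [x x0 xA]] := top_eigenvalue A_sym (ltnW n_gt1).
rewrite -/M in le_M eq_M xA.
pose z : 'rV[R]_n := \row_i `|x 0 i|.
have z_ge0 i : 0 <= z 0 i by rewrite mxE.
have sqnorm_z : sqnorm z = sqnorm x.
  by apply: eq_bigr => i _; rewrite mxE real_normK ?num_real.
have bilin_z : bilin A z z = M * sqnorm z.
  apply/eqP; rewrite eq_le le_M /= sqnorm_z.
  have -> : M * sqnorm x = bilin A x x by rewrite /bilin xA -scalemxAl mxE -sqnormE.
  rewrite !bilinE; apply: ler_sum => i _; apply: ler_sum => j _.
  rewrite !mxE; apply: le_trans (ler_norm _) _.
  by rewrite !normrM (ger0_norm (A_ge0 i j)).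
exists z => // i; rewrite lt_def z_ge0 andbT; apply/eqP => zi0.
have zA := eq_M z bilin_z.
have sum0 : \sum_j z 0 j * A j i = 0.
  have /matrixP/(_ 0 i) := zA; rewrite !mxE -/(z 0 i) => ->.
  by move: zi0; rewrite !mxE => ->; rewrite mulr0.
have z0 j : z 0 j = 0.
  have [->//|ji] := eqVneq j i.
  have term_ge0 k : 0 <= z 0 k * A k i by rewrite mulr_ge0.
  move/eqP: sum0; rewrite psumr_eq0 // => /allP/(_ j (mem_index_enum j)).
  by rewrite /= mulf_eq0 (gt_eqF (A_gt0 _ _ ji)) orbF => /eqP.
case/eqP: x0; apply/rowP => j; apply/eqP.
by have := z0 j; rewrite !mxE => /eqP; rewrite normr_eq0.
Qed.

End TopEigenvalue.

(** * The distance alpha-matrix *)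

Lemma wsumT (R : realDomainType) (V : finType) (w : V -> V -> R) d :
  wsum w [set: V] d = \sum_a \sum_b w a b * (d a b)%:R.
Proof.
rewrite /wsum; under eq_bigl => a do rewrite finset.in_setT.
by apply: eq_bigr => a _; apply: eq_bigl => b; rewrite finset.in_setT.
Qed.

Lemma wsum_bij (R : realDomainType) (V W : finType) (h : W -> V) (w : V -> V -> R) d :
  bijective h ->
  wsum w [set: V] d = wsum (fun a b => w (h a) (h b)) [set: W] (fun a b => d (h a) (h b)).
Proof.
move=> h_bij; rewrite !wsumT (reindex h) /=; last exact: onW_bij.
by apply: eq_bigr => a _; rewrite (reindex h) //=; apply: onW_bij.
Qed.

Section DistanceAlphaForm.
Variables (R : realType) (alpha : R).
Hypotheses (alpha_ge0 : 0 <= alpha) (alpha_lt1 : alpha < 1).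

(* [2 f D_alpha f^T] is the sum of the distances with these weights, since the transmission part
   splits evenly between [f a ^+ 2] and [f b ^+ 2]. *)
Definition alpha_weight (V : Type) (f : V -> R) (a b : V) : R :=
  alpha * (f a ^+ 2 + f b ^+ 2) + 2 * (1 - alpha) * (f a * f b).

Lemma positive_alpha_weight (V : finType) (f : V -> R) :
  (forall a, 0 < f a) -> positive (alpha_weight f).
Proof.
move=> f_gt0 a b; have := mulr_gt0 (f_gt0 a) (f_gt0 b).
have := sqr_ge0 (f a); have := sqr_ge0 (f b); rewrite /alpha_weight.
move: (f a ^+ 2) (f b ^+ 2) (f a * f b) => x y z y0 x0 z0.
have := mulr_ge0 alpha_ge0 (addr_ge0 x0 y0).
have : 0 < (1 - alpha) * z by rewrite mulr_gt0 // subr_gt0.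
lra.
Qed.

Variable G : sgraph.

Definition vertex_row (f : G -> R) : 'rV[R]_#|G| := \row_i f (enum_val i).

Lemma sum_enum_val (F : G -> R) : \sum_(i < #|G|) F (enum_val i) = \sum_a F a.
Proof. by rewrite [RHS](reindex (enum_val (A := G))) //=; apply/onW_bij/enum_val_bij. Qed.

Lemma sqnorm_vertex_row f : sqnorm (vertex_row f) = \sum_a f a ^+ 2.
Proof. by rewrite -sum_enum_val; apply: eq_bigr => i _; rewrite mxE. Qed.

Lemma distance_alpha_mx_sym : (distance_alpha_mx alpha G)^T = distance_alpha_mx alpha G.
Proof.
rewrite /distance_alpha_mx linearD /= !linearZ /= tr_diag_mx; congr (_ + _ *: _).
by apply/matrixP => i j; rewrite !mxE gdistC.
Qed.

Lemma distance_alpha_mxE i j : distance_alpha_mx alpha G i j =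
  alpha * ((transmission (enum_val i))%:R *+ (i == j)) +
  (1 - alpha) * (gdist (enum_val i) (enum_val j))%:R.
Proof. by rewrite !mxE. Qed.

Lemma alpha_form f : bilin (distance_alpha_mx alpha G) (vertex_row f) (vertex_row f) * 2 =
  wsum (alpha_weight f) [set: G] (@gdist G).
Proof.
have -> : bilin (distance_alpha_mx alpha G) (vertex_row f) (vertex_row f) =
    alpha * (\sum_a \sum_b f a ^+ 2 * (gdist a b)%:R) +
    (1 - alpha) * (\sum_a \sum_b f a * f b * (gdist a b)%:R).
  rewrite bilinE -!sum_enum_val !mulr_sumr -big_split; apply: eq_bigr => i _ /=.
  rewrite -!sum_enum_val !mulr_sumr.
  under eq_bigr => j _ do rewrite distance_alpha_mxE mulrDr mulrDl !mxE.
  rewrite big_split /=; congr (_ + _); last by apply: eq_bigr => j _; ring.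
  rewrite (bigD1 i) //= eqxx big1 ?addr0 => [|j]; last first.
    by rewrite eq_sym => /negbTE->; rewrite mulr0n !(mulr0, mul0r).
  rewrite /transmission natr_sum -!mulr_sumr (sum_enum_val (fun b => (gdist (enum_val i) b)%:R)).
  by rewrite mulr1n; ring.
have swap : \sum_a \sum_b f a ^+ 2 * (gdist a b)%:R = \sum_a \sum_b f b ^+ 2 * (gdist a b)%:R.
  by rewrite exchange_big; apply: eq_bigr => a _; apply: eq_bigr => b _; rewrite gdistC.
rewrite wsumT; set X := \sum_a _ in swap *; set Y := \sum_a \sum_b f a * _ * _.
transitivity (alpha * (X + \sum_a \sum_b f b ^+ 2 * (gdist a b)%:R) + (1 - alpha) * 2 * Y).
  by rewrite -swap; ring.
rewrite /X /Y -big_split !mulr_sumr -big_split; apply: eq_bigr => a _ /=.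
rewrite -big_split !mulr_sumr -big_split; apply: eq_bigr => b _ /=.
by rewrite /alpha_weight; ring.
Qed.

Lemma alpha_form_le f : (0 < #|G|)%N ->
  wsum (alpha_weight f) [set: G] (@gdist G) <= mu alpha G * (\sum_a f a ^+ 2) * 2.
Proof.
move=> G_gt0; rewrite -alpha_form ler_pM2r // -sqnorm_vertex_row.
by have [le_mu _ _] := top_eigenvalue distance_alpha_mx_sym G_gt0; apply: le_mu.
Qed.

Lemma alpha_form_perron : (1 < #|G|)%N -> exists2 f : G -> R, forall a, 0 < f a &
  wsum (alpha_weight f) [set: G] (@gdist G) = mu alpha G * (\sum_a f a ^+ 2) * 2.
Proof.
move=> G_gt1; have alpha1 : 0 < 1 - alpha by rewrite subr_gt0.
have [|i j ij|z z_gt0 zA] := perron_vector distance_alpha_mx_sym G_gt1.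
- move=> i j; rewrite distance_alpha_mxE; apply: addr_ge0.
    by rewrite mulr_ge0 // mulrn_wge0.
  by rewrite mulr_ge0 // ltW.
- rewrite distance_alpha_mxE (negbTE ij) mulr0n mulr0 add0r mulr_gt0 // ltr0n.
  by apply: gdist_gt0; apply: contraNneq ij => /enum_val_inj->.
exists (fun a => z 0 (enum_rank a)) => [a|]; first exact: z_gt0.
have z_row : vertex_row (fun a => z 0 (enum_rank a)) = z.
  by apply/rowP => i; rewrite mxE enum_valK.
by rewrite -alpha_form -sqnorm_vertex_row z_row zA.
Qed.

End DistanceAlphaForm.

(** * Isomorphism invariance and the extremal kite *)

Lemma isomorphic_sym (G H : sgraph) : isomorphic G H -> isomorphic H G.
Proof.
case=> f [g fK gK] f_adj; exists g; first by exists f.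
by move=> x y; rewrite -f_adj !gK.
Qed.

(** The Perron vector of [G], carried over to [H], is a test vector there. *)
Lemma isomorphic_mu_le (R : realType) (alpha : R) (G H : sgraph) :
    0 <= alpha -> alpha < 1 -> (1 < #|G|)%N -> isomorphic G H -> mu alpha G <= mu alpha H.
Proof.
move=> a0 a1 G_gt1 [h h_bij h_adj]; have cardGH : #|G| = #|H| := bij_eq_card h_bij.
have [f f_gt0 f_mu] := alpha_form_perron a0 a1 G_gt1.
have [g hK gK] := h_bij; have g_bij : bijective g by exists h.
have sum_f : \sum_a f a ^+ 2 = \sum_b f (g b) ^+ 2.
  by rewrite (reindex g) //; apply: onW_bij.
have sum_gt0 : 0 < \sum_a f a ^+ 2.
  have /card_gt0P[a _] := ltnW G_gt1; rewrite (bigD1 a) //=; apply: ltr_wpDr.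
    by apply: sumr_ge0 => b _; apply: sqr_ge0.
  by rewrite exprn_gt0.
rewrite -(ler_pM2r sum_gt0) -(@ler_pM2r _ 2) // -f_mu sum_f.
apply: le_trans (alpha_form_le alpha (f \o g) _); last by rewrite -cardGH ltnW.
rewrite (wsum_bij _ _ g_bij); apply: le_wsum.
  by apply: (positive_alpha_weight a0 a1 (f := f \o g)) => b; apply: f_gt0.
move=> x y _ _; apply: le_gdist_iso => // u v.
by rewrite -h_adj !gK.
Qed.

Lemma isomorphic_mu (R : realType) (alpha : R) (G H : sgraph) :
    0 <= alpha -> alpha < 1 -> (1 < #|G|)%N -> isomorphic G H -> mu alpha G = mu alpha H.
Proof.
move=> a0 a1 G_gt1 GH; apply/eqP; rewrite eq_le !isomorphic_mu_le //.
- by case: GH => h /bij_eq_card <-.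
- exact: isomorphic_sym.
Qed.

Theorem theorem6p4 (R : realType) (alpha : R) (n : nat) (G : sgraph)
    (alpha_ge0 : 0 <= alpha) (alpha_lt1 : alpha < 1)
    (n_ge3 : (3 <= n)%N) (card_G : #|G| = n) (G_uni : unicyclic_odd G) :
  mu alpha G <= mu alpha (kite n) /\
  (mu alpha G = mu alpha (kite n) <-> isomorphic G (kite n)).
Proof.
have G_gt1 : (1 < #|G|)%N by rewrite card_G; lia.
have [f f_gt0 f_mu] := alpha_form_perron alpha_ge0 alpha_lt1 G_gt1.
have w_gt0 := positive_alpha_weight alpha_ge0 alpha_lt1 f_gt0.
have [t [uniq_t tG dist_t]] := gdist_dominated G_uni w_gt0.
have size_t : size t = n by rewrite -(card_uniqP uniq_t) (eq_card tG) cardsT.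
have x0 : G by move: (ltnW G_gt1) => /card_gt0P/sigW[].
have mem_t a : a \in t by rewrite tG finset.in_setT.
have index_t a : (index a t < n)%N by rewrite -size_t index_mem.
pose h (i : kite n) : G := nth x0 t i.
pose g (a : G) : kite n := Ordinal (index_t a).
have hK : cancel h g by move=> i; apply: val_inj; rewrite /= index_uniq ?size_t.
have gK : cancel g h by move=> a; rewrite /h /= nth_index.
have h_bij : bijective h by exists g.
have sum_f : \sum_a f a ^+ 2 = \sum_i f (h i) ^+ 2.
  by rewrite (reindex h) //; apply: onW_bij.
have sum_gt0 : 0 < \sum_a f a ^+ 2.
  rewrite (bigD1 x0) //=; apply: ltr_wpDr; last by rewrite exprn_gt0.
  by apply: sumr_ge0 => b _; apply: sqr_ge0.
(* The Perron vector [f] of [G], renumbered by [h], is a test vector for [kite n]. *)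
have kite_mu : wsum (alpha_weight alpha f) [set: G] (seq_kite_dist t) <=
    mu alpha (kite n) * (\sum_a f a ^+ 2) * 2.
  rewrite sum_f; apply: le_trans (alpha_form_le alpha (f \o h) _); last by rewrite card_ord; lia.
  rewrite (wsum_bij _ _ h_bij); apply: le_wsum => [i j|i j _ _]; first exact: w_gt0.
  by rewrite /seq_kite_dist !index_uniq ?size_t //; apply: kite_dist_le_gdist.
have le_mu_of_wsum : wsum (alpha_weight alpha f) [set: G] (@gdist G) <=
    wsum (alpha_weight alpha f) [set: G] (seq_kite_dist t) -> mu alpha G <= mu alpha (kite n).
  by move=> /le_trans/(_ kite_mu); rewrite f_mu ler_pM2r // ler_pM2r.
split.
  by apply: le_mu_of_wsum; case: dist_t => [/eq_wsum->//|/ltW].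
split=> [mu_eq|]; last exact: isomorphic_mu.
(* Equal radii exclude the strict alternative, so the distances agree under [g], and adjacency is
   distance 1 in both graphs. *)
case: dist_t => [dist_t|lt_t]; last first.
  by have := lt_le_trans lt_t kite_mu; rewrite f_mu mu_eq ltxx.
exists g; first by exists h.
by move=> a b; rewrite kite_adjE adj_gdist dist_t ?finset.in_setT.
Qed.
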